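(* Let $p$ be a prime number with $p\equiv 3 \pmod 4$, let $\mathbb{Q}_p(i)$ with $i^2=-1$ be the unramified quadratic extension of $\mathbb{Q}_p$, let $\overline{a+ib}=a-ib$ for $a,b\in\mathbb{Q}_p$ denote conjugation, and let $|\cdot|_p$ denote the extension of the $p$-adic absolute value to $\mathbb{Q}_p(i)$. Let $D=\{\xi\in\mathbb{Q}_p(i): |\xi|_p<1\}$ and define $$\xi_1\oplus\xi_2=\frac{\xi_1+\xi_2}{1-\overline{\xi_1}\,\xi_2},\qquad \xi_1,\xi_2\in D.$$ Then $(D,0,\oplus)$ is an $A_l$-loop (in particular a loop defined on all of $D$, with $\oplus$ a well-defined binary operation $D\times D\to D$ and neutral element $0$) and it has the left inverse property.
   Context: A loop $(L,e,\oplus)$ is a set $L$ with a binary operation $\oplus$ and an element $e\in L$ such that $a\oplus e=e\oplus a=a$ for all $a\in L$ and, for all $a,b\in L$, each of the equations $a\oplus x=b$ and $y\oplus a=b$ has a unique solution in $L$. The left translations are the bijections $\lambda_a:x\mapsto a\oplus x$, and the left inner deviations are the maps $\delta_{a,b}=\lambda_{a\oplus b}^{-1}\lambda_a\lambda_b$ for $a,b\in L$. The loop is an $A_l$-loop if every left inner deviation (equivalently, every element of the group they generate, which is the stabilizer of $e$ in the group generated by all left translations) is an automorphism of $(L,\oplus)$. The loop has the left inverse property if for every $a\in L$ there is $a'\in L$ such that $a'\oplus(a\oplus x)=x$ for all $x\in L$. *)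

(* Defs.v *)
From HB Require Import structures.
From mathcomp Require Import all_boot all_order all_algebra.
From mathcomp Require finfield.
From mathcomp Require Import ring lra zify.
From mathcomp Require Import all_classical all_reals all_analysis.
Set Implicit Arguments.
Unset Strict Implicit.
Unset Printing Implicit Defensive.
Import Order.TTheory GRing.Theory Num.Theory.
Import numFieldNormedType.Exports.
Local Open Scope classical_set_scope.
Local Open Scope ring_scope.

(* The p-adic absolute value on the rationals: |n / d| = p^(v(d) - v(n)). *)
Definition rat_abs (p : nat) (x : rat) : rat :=
  if x == 0 then 0
  else p%:R ^ ((logn p `|denq x|%N)%:Z - (logn p `|numq x|%N)%:Z).

Section RatAbs.
Variables (p : nat) (hp : prime p).
Local Notation N := (rat_abs p).
Implicit Types x y : rat.

Let p_gt0 : 0 < p%:R :> rat. Proof. by rewrite ltr0n prime_gt0. Qed.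
Let p_neq0 : p%:R != 0 :> rat. Proof. by rewrite gt_eqF. Qed.
Let p_gt1 : 1 < p%:R :> rat. Proof. by rewrite ltr1n prime_gt1. Qed.

Lemma rat_abs0 : N 0 = 0. Proof. by rewrite /rat_abs eqxx. Qed.

Lemma rat_abs_frac (n d : int) : n != 0 -> d != 0 ->
  N (n%:Q / d%:Q) = p%:R ^ ((logn p `|d|%N)%:Z - (logn p `|n|%N)%:Z).
Proof.
move=> n0 d0; have nQ : n%:Q != 0 by rewrite intr_eq0.
have dQ : d%:Q != 0 by rewrite intr_eq0.
set x := n%:Q / d%:Q; have x0 : x != 0 by rewrite mulf_neq0 ?invr_eq0.
rewrite /rat_abs (negbTE x0); congr (_ ^ _).
have E : (numq x * d = n * denq x)%R.
  apply/(@intr_inj rat); rewrite !intrM numqE.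
  by rewrite mulrAC /x divfK.
have /(congr1 (fun z : int => logn p `|z|%N)) := E.
rewrite !abszM !lognM ?absz_gt0 ?denq_neq0 ?numq_eq0 //; lia.
Qed.

Lemma rat_absE x : x != 0 -> exists m : int, N x = p%:R ^ m.
Proof. by move=> x0; rewrite /rat_abs (negbTE x0); eexists. Qed.

Lemma rat_abs_ge0 x : 0 <= N x.
Proof.
by have [->|/rat_absE [m ->]] := eqVneq x 0; rewrite ?rat_abs0 // exprz_ge0 ?ltW.
Qed.

Lemma rat_abs_eq0 x : (N x == 0) = (x == 0).
Proof.
have [->|x0] := eqVneq x 0; first by rewrite rat_abs0 eqxx.
by have [m ->] := rat_absE x0; apply/negbTE/expfz_neq0.
Qed.

Lemma rat_absM x y : N (x * y) = N x * N y.
Proof.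
have [->|x0] := eqVneq x 0; first by rewrite mul0r rat_abs0 mul0r.
have [->|y0] := eqVneq y 0; first by rewrite mulr0 rat_abs0 mulr0.
rewrite -[x]divq_num_den -[y]divq_num_den mulf_div -!intrM.
rewrite !rat_abs_frac ?mulf_neq0 ?denq_neq0 ?numq_eq0 //.
rewrite -expfzDr // !abszM !lognM ?absz_gt0 ?denq_neq0 ?numq_eq0 //.
congr (_ ^ _); lia.
Qed.

Lemma rat_abs1 : N 1 = 1.
Proof.
have := rat_absM 1 1; rewrite mulr1 => /esym/eqP.
by rewrite -subr_eq0 -{3}[N 1]mulr1 -mulrBr mulf_eq0 rat_abs_eq0 oner_eq0
  subr_eq0 => /eqP.
Qed.

Lemma rat_absX x n : N (x ^+ n) = N x ^+ n.
Proof. by elim: n => [|n IH]; rewrite ?rat_abs1 // !exprS rat_absM IH. Qed.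

Lemma rat_absN x : N (- x) = N x.
Proof. by rewrite /rat_abs oppr_eq0 numqN denqN abszN. Qed.

Lemma rat_absB x y : N (x - y) = N (y - x).
Proof. by rewrite -rat_absN opprB. Qed.

Lemma rat_absV x : N x^-1 = (N x)^-1.
Proof.
have [->|x0] := eqVneq x 0; first by rewrite rat_abs0 !invr0 rat_abs0.
have Nx0 : N x != 0 by rewrite rat_abs_eq0.
by apply: (mulfI Nx0); rewrite -rat_absM !divff // rat_abs1.
Qed.

Lemma rat_abs_int (n : int) : N n%:Q <= 1.
Proof.
have [->|n0] := eqVneq n 0; first by rewrite rat_abs0.
rewrite -[n%:Q]divr1 -[1]/(1%:Q) rat_abs_frac //.
by rewrite logn1 sub0r -invr_expz invf_le1 ?exprn_gt0 // exprn_ege1 // ltW.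
Qed.

Lemma rat_abs_le1 x : N x <= 1 -> (~~ (p %| `|denq x|)%N).
Proof.
have [->|x0] := eqVneq x 0.
  by move=> _; rewrite dvdn1; apply: contraTN hp => /eqP ->.
rewrite /rat_abs (negbTE x0); apply: contraTN => pd; rewrite -ltNge.
have pn : ~~ (p %| `|numq x|)%N.
  apply: contraTN (coprime_num_den x) => pn.
  have : (p %| gcdn `|numq x| `|denq x|)%N by rewrite dvdn_gcd pn.
  rewrite /coprime => pg; apply: contraTN pg => /eqP ->.
  by rewrite dvdn1; apply: contraTN hp => /eqP ->.
have -> : logn p `|numq x| = 0%N.
  by apply/eqP; rewrite -leqn0 leqNgt logn_gt0 mem_primes (negbTE pn) !andbF.
have : (0 < logn p `|denq x|)%N.
  by rewrite logn_gt0 mem_primes hp pd absz_gt0 denq_neq0.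
by rewrite subr0; case: (logn _ _) => // k _; rewrite -exprnP exprn_egt1.
Qed.

Lemma rat_abs_coprime (n : int) : ~~ (p %| `|n|)%N -> N n%:Q = 1.
Proof.
move=> pn; have n0 : n != 0 by apply: contraNneq pn => ->; rewrite dvdn0.
rewrite -[n%:Q]divr1 -[1 in LHS]/(1%:Q) rat_abs_frac // logn1.
suff -> : logn p `|n| = 0%N by [].
by apply/eqP; rewrite -leqn0 leqNgt logn_gt0 mem_primes (negbTE pn) !andbF.
Qed.

Lemma rat_absD1 x : N x <= 1 -> N (1 + x) <= 1.
Proof.
move=> /rat_abs_le1 pd.
have dQ : (denq x)%:Q != 0 by rewrite intr_eq0 denq_neq0.
have -> : 1 + x = (denq x + numq x)%:~R / (denq x)%:~R.
  by rewrite intrD mulrDl divff // divq_num_den.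
by rewrite rat_absM rat_absV (rat_abs_coprime pd) invr1 mulr1 rat_abs_int.
Qed.

Lemma rat_absD x y : N (x + y) <= Num.max (N x) (N y).
Proof.
wlog le_yx : x y / N y <= N x.
  move=> H; case: (leP (N y) (N x)) => [|/ltW] h; first by rewrite -(max_idPl h) H.
  by rewrite addrC -(max_idPl h) H.
rewrite (max_idPl le_yx); have [x0|x0] := eqVneq x 0.
  by move: le_yx; rewrite x0 rat_abs0 le_eqVlt ltNge rat_abs_ge0 orbF rat_abs_eq0 => /eqP ->; rewrite addr0 rat_abs0.
have -> : x + y = x * (1 + y / x) by rewrite mulrDr mulr1 mulrCA divff ?mulr1.
rewrite rat_absM ler_piMr ?rat_abs_ge0 // rat_absD1 // rat_absM rat_absV.
by rewrite ler_pdivrMr ?mul1r // lt_def rat_abs_ge0 rat_abs_eq0 x0.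
Qed.

Lemma rat_abs_triangle x y : N (x + y) <= N x + N y.
Proof.
by rewrite (le_trans (rat_absD _ _)) // ge_max lerDl lerDr !rat_abs_ge0.
Qed.

Lemma rat_abs_dist x y : `|N x - N y| <= N (x - y).
Proof.
rewrite ler_norml; apply/andP; split.
  by have := rat_abs_triangle (y - x) x; rewrite subrK (rat_absB y x); lra.
by have := rat_abs_triangle (x - y) y; rewrite subrK; lra.
Qed.

Section ThreeModFour.
Hypothesis hp3 : p = 3 %[mod 4].

Lemma sum_sq_dvd (n d : int) : (p %| `|(n ^+ 2 + d ^+ 2)%R|)%N -> (p %| `|d|)%N.
Proof.
move=> pnd; apply/negPn/negP => pd.
have chF := pchar_Fp hp.
have F0 (z : int) : (z%:~R == 0 :> 'F_p) = (p %| `|z|)%N.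
  by case: z => k; rewrite ?NegzE ?mulrNz ?oppr_eq0 ?abszN -pmulrn
    (dvdn_pcharf chF).
move: pnd; rewrite -F0 rmorphD !rmorphXn /= => /eqP E.
have d0 : d%:~R != 0 :> 'F_p by rewrite F0.
set t := (n%:~R / d%:~R : 'F_p).
have t2 : t ^+ 2 = -1.
  rewrite expr_div_n; apply: (canLR (mulfK _)); first by rewrite expf_neq0.
  by rewrite mulN1r; apply/eqP; rewrite -addr_eq0 E.
have tp : t ^+ p = t by have := finfield.expf_card t; rewrite card_Fp.
have t0 : t != 0.
  by apply: contraTneq isT => t0; move/eqP: t2; rewrite t0 expr0n /= eq_sym oppr_eq0 oner_eq0.
have pE : p = ((p %/ 4 * 2 + 1) * 2).+1 by lia.
have : t ^+ ((p %/ 4 * 2 + 1) * 2).+1 = t by rewrite -pE.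
rewrite exprS mulnC exprM t2 exprD mulnC exprM sqrrN !expr1n mul1r expr1.
rewrite mulrN1 => /eqP; rewrite eq_sym -addr_eq0 -mulr2n -mulr_natr mulf_eq0.
rewrite (negbTE t0) /= -(dvdn_pcharf chF) => /dvdn_leq; lia.
Qed.

Lemma rat_abs_sum_sq x y : N (x ^+ 2 + y ^+ 2) = Num.max (N x) (N y) ^+ 2.
Proof.
wlog le_yx : x y / N y <= N x.
  move=> H; case: (leP (N y) (N x)) => [|/ltW] h; first by rewrite -(max_idPl h) H.
  by rewrite addrC -(max_idPl h) H.
rewrite (max_idPl le_yx); have [x0|x0] := eqVneq x 0.
  have /eqP y0 : y == 0.
    by rewrite -rat_abs_eq0 eq_le rat_abs_ge0 andbT -rat_abs0 -x0.
  by rewrite x0 y0 !expr2 mulr0 addr0 rat_abs0.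
have le1 : N (y / x) <= 1.
  rewrite rat_absM rat_absV ler_pdivrMr ?mul1r //.
  by rewrite lt_def rat_abs_ge0 rat_abs_eq0 x0.
have -> : x ^+ 2 + y ^+ 2 = x ^+ 2 * (1 + (y / x) ^+ 2) by field.
rewrite rat_absM rat_absX; set t := y / x in le1 *.
suff -> : N (1 + t ^+ 2) = 1 by rewrite mulr1.
have pd := rat_abs_le1 le1.
have dQ : (denq t)%:Q != 0 by rewrite intr_eq0 denq_neq0.
have -> : 1 + t ^+ 2 = (numq t ^+ 2 + denq t ^+ 2)%:~R / (denq t)%:~R ^+ 2.
  by rewrite intrD !rmorphXn /= -{1}[t]divq_num_den; field.
rewrite rat_absM rat_absV rat_absX (rat_abs_coprime pd) expr1n invr1 mulr1.
by apply: rat_abs_coprime; apply: contra pd => /sum_sq_dvd.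
Qed.
End ThreeModFour.
End RatAbs.

(* The argument [hp] makes the type depend on a primality proof, without which
   [rat_abs p] is not multiplicative. *)
Definition is_cauchy (p : nat) (hp : prime p) : {pred nat -> rat} := fun u =>
  `[< forall e : rat, 0 < e -> exists n0 : nat, forall m n : nat,
        (n0 <= m)%N -> (n0 <= n)%N -> rat_abs p (u m - u n) < e >].

Record cauchySeq (p : nat) (hp : prime p) := CauchySeq {
  cseq :> nat -> rat;
  _ : cseq \in is_cauchy hp
}.

HB.instance Definition _ p (hp : prime p) := [isSub for @cseq p hp].
HB.instance Definition _ p (hp : prime p) := [Choice of cauchySeq hp by <:].

Section CauchyRing.
Variables (p : nat) (hp : prime p).
Local Notation N := (rat_abs p).

Lemma is_cauchyP (u : nat -> rat) :
  reflect (forall e : rat, 0 < e -> exists n0 : nat, forall m n : nat,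
             (n0 <= m)%N -> (n0 <= n)%N -> N (u m - u n) < e)
          (u \in is_cauchy hp).
Proof. exact: asboolP. Qed.

Lemma cauchy_bounded (u : nat -> rat) : u \in is_cauchy hp ->
  exists n0 : nat, exists2 M : rat, 0 < M & forall n, (n0 <= n)%N -> N (u n) <= M.
Proof.
move=> /is_cauchyP /(_ 1 ltr01) [n0 H].
exists n0, (N (u n0) + 1); first by rewrite ltr_wpDl ?rat_abs_ge0.
move=> n le_n; rewrite -[u n](subrK (u n0)) (le_trans (rat_abs_triangle _ _ _)) //.
by rewrite addrC lerD2l ltW // H.
Qed.

Lemma is_cauchy_subring : subring_closed (is_cauchy hp).
Proof.
split=> [|u v /is_cauchyP Hu /is_cauchyP Hv|u v Hu Hv].
- by apply/is_cauchyP => e e0; exists 0%N => m n _ _; rewrite subrr rat_abs0.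
- apply/is_cauchyP => e e0.
  have [n1 H1] := Hu _ e0; have [n2 H2] := Hv _ e0.
  exists (maxn n1 n2) => m n; rewrite !geq_max => /andP[? ?] /andP[? ?].
  have -> : (u - v) m - (u - v) n = (u m - u n) + (v n - v m).
    by rewrite !fctE; ring.
  by rewrite (le_lt_trans (rat_absD _ _ _)) // gt_max H1 // H2.
- have [n1 [M1 M10 B1]] := cauchy_bounded Hu.
  have [n2 [M2 M20 B2]] := cauchy_bounded Hv.
  move/is_cauchyP: Hu => Hu; move/is_cauchyP: Hv => Hv.
  apply/is_cauchyP => e e0.
  have [n3 H3] := Hu _ (divr_gt0 e0 M20); have [n4 H4] := Hv _ (divr_gt0 e0 M10).
  exists (maxn (maxn n1 n2) (maxn n3 n4)) => m n.
  rewrite !geq_max => /andP[/andP[? ?] /andP[? ?]] /andP[/andP[? ?] /andP[? ?]].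
  have -> : (u * v) m - (u * v) n = (u m - u n) * v m + u n * (v m - v n).
    by rewrite !fctE; ring.
  rewrite (le_lt_trans (rat_absD _ _ _)) // gt_max !rat_absM //; apply/andP; split.
    rewrite (@le_lt_trans _ _ (N (u m - u n) * M2)) //.
      by rewrite ler_wpM2l ?rat_abs_ge0 ?B2.
    by rewrite -ltr_pdivlMr // H3.
  rewrite (@le_lt_trans _ _ (M1 * N (v m - v n))) //.
    by rewrite ler_wpM2r ?rat_abs_ge0 ?B1.
  by rewrite mulrC -ltr_pdivlMr // H4.
Qed.

HB.instance Definition _ :=
  GRing.isSubringClosed.Build (nat -> rat) (is_cauchy hp) is_cauchy_subring.
HB.instance Definition _ :=
  [SubChoice_isSubComNzRing of cauchySeq hp by <:].

End CauchyRing.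

Definition is_null (p : nat) (hp : prime p) : {pred cauchySeq hp} := fun u =>
  `[< forall e : rat, 0 < e -> exists n0 : nat, forall n : nat,
        (n0 <= n)%N -> rat_abs p (u n) < e >].
Arguments is_null {p} hp.

Section NullIdeal.
Variables (p : nat) (hp : prime p).
Local Notation N := (rat_abs p).

Lemma is_nullP (u : cauchySeq hp) :
  reflect (forall e : rat, 0 < e -> exists n0 : nat, forall n : nat,
             (n0 <= n)%N -> N (u n) < e)
          (u \in is_null hp).
Proof. exact: asboolP. Qed.

Lemma is_null_ideal : idealr_closed (is_null hp).
Proof.
split=> [||a u v /is_nullP Hu /is_nullP Hv].
- by apply/is_nullP => e e0; exists 0%N => n _; rewrite rat_abs0.
- apply/is_nullP => /(_ 1 ltr01) [n0 /(_ n0 (leqnn _))].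
  by rewrite rat_abs1 ?ltxx.
- have [n1 [M M0 B]] := cauchy_bounded (valP a).
  apply/is_nullP => e e0.
  have [n2 H2] := Hu _ (divr_gt0 e0 M0); have [n3 H3] := Hv _ e0.
  exists (maxn n1 (maxn n2 n3)) => n; rewrite !geq_max => /and3P[? ? ?].
  have -> : (a * u + v : cauchySeq hp) n = a n * u n + v n by [].
  rewrite (le_lt_trans (rat_absD _ _ _)) // gt_max H3 // andbT rat_absM //.
  rewrite (@le_lt_trans _ _ (M * N (u n))) //.
    by rewrite ler_wpM2r ?rat_abs_ge0 // B.
  by rewrite mulrC -ltr_pdivlMr // H2.
Qed.

HB.instance Definition _ :=
  isIdealr.Build (cauchySeq hp) (is_null hp) is_null_ideal.

End NullIdeal.

(* The completion of the rationals for the p-adic absolute value: Cauchy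
   sequences modulo null sequences. *)
Definition Qp (p : nat) (hp : prime p) : Type := {ideal_quot (is_null hp)}.

Section QpField.
Variables (p : nat) (hp : prime p).
Local Notation N := (rat_abs p).

HB.instance Definition _ := GRing.ComNzRing.on (Qp hp).
HB.instance Definition _ := NzRingQuotient.on (Qp hp).

Definition Qp_inv (x : Qp hp) : Qp hp :=
  if x == 0 then 0 else xget 0 [set y | y * x = 1].

Lemma Qp_eq0 (u : cauchySeq hp) : (\pi_(Qp hp) u == 0)%qT = (u \in is_null hp).
Proof. by rewrite -[u in RHS]subr0 Quotient.idealrBE pi_zeror. Qed.

Lemma pi_QpD (u v : cauchySeq hp) :
  (\pi_(Qp hp) (u + v) = \pi_(Qp hp) u + \pi_(Qp hp) v)%qT.
Proof. by rewrite rmorphD. Qed.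

Lemma pi_QpM (u v : cauchySeq hp) :
  (\pi_(Qp hp) (u * v) = \pi_(Qp hp) u * \pi_(Qp hp) v)%qT.
Proof. by rewrite rmorphM. Qed.

Lemma pi_Qp1 : (\pi_(Qp hp) 1 = 1)%qT.
Proof. by rewrite rmorph1. Qed.

Lemma not_null_away (u : cauchySeq hp) : u \notin is_null hp ->
  exists n0, exists2 e : rat, 0 < e & forall n, (n0 <= n)%N -> e <= N (u n).
Proof.
move=> /is_nullP /existsNP [e] /not_implyP [e0] /forallNP H.
have /is_cauchyP /(_ _ e0) [n0 Hn] := valP u.
exists n0, e => // n le_n; rewrite leNgt; apply/negP => lt_e.
apply: (H n0) => m le_m; rewrite -[u m](subrK (u n)).
by rewrite (le_lt_trans (rat_absD _ _ _)) // gt_max Hn.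
Qed.

Lemma Qp_mulVf (x : Qp hp) : x != 0 -> Qp_inv x * x = 1.
Proof.
move=> x0; rewrite /Qp_inv (negbTE x0).
suff : exists y, [set y | y * x = 1] y by apply: xgetPex.
move: x0; rewrite -[x]reprK; move: (repr x) => u.
rewrite Qp_eq0 => /not_null_away [n0 [e e0 He]].
have u0 n : (n0 <= n)%N -> u n != 0.
  by move=> /He; apply: contraTneq => ->; rewrite rat_abs0 -ltNge.
have Cv : (fun n => (u n)^-1) \in is_cauchy hp.
  apply/is_cauchyP => d d0.
  have /is_cauchyP /(_ (d * (e * e))) [|n1 H1] := valP u.
    by rewrite !mulr_gt0.
  exists (maxn n0 n1) => m n; rewrite !geq_max => /andP[m0 m1] /andP[n0' n1'].
  have -> : (u m)^-1 - (u n)^-1 = (u n - u m) / (u m * u n).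
    by field; rewrite !u0.
  rewrite rat_absM // rat_absV // ltr_pdivrMr; last first.
    by rewrite lt_def rat_abs_ge0 // rat_abs_eq0 // mulf_neq0 ?u0.
  apply: lt_le_trans (H1 _ _ n1' m1) _; rewrite rat_absM //.
  by rewrite ler_wpM2l ?(ltW d0) // ler_pM ?(ltW e0) ?He.
exists (\pi_(Qp hp) (CauchySeq Cv))%qT => /=.
rewrite -pi_QpM -pi_Qp1; apply/eqP; rewrite -Quotient.idealrBE.
apply/is_nullP => d d0; exists n0 => n /u0 un0.
set w := (_ - _ : cauchySeq hp).
have -> : w n = (u n)^-1 * u n - 1 by [].
by rewrite mulVf // subrr rat_abs0.
Qed.

Lemma Qp_inv0 : Qp_inv 0 = 0. Proof. by rewrite /Qp_inv eqxx. Qed.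

HB.instance Definition _ := GRing.ComNzRing_isField.Build (Qp hp) Qp_mulVf Qp_inv0.


End QpField.

(* The limit does not depend on the representative: see [Qp_abs_cvg]. *)
Definition Qp_abs (R : realType) (p : nat) (hp : prime p) (x : Qp hp) : R :=
  lim ((fun n : nat => ratr (rat_abs p (repr x n)) : R) @ \oo).

Section QpAbs.
Variables (R : realType) (p : nat) (hp : prime p).
Local Notation N := (rat_abs p).

Lemma cvg_rat_abs (u : cauchySeq hp) :
  cvg ((fun n : nat => ratr (N (u n)) : R) @ \oo).
Proof.
apply: cauchy_cvg; apply: cauchy_exP => e e0.
have [q] := rat_in_itvoo e0; rewrite in_itv /= => /andP[q0 qe].
have q0' : 0 < q by rewrite -(ltr0q R).
have /is_cauchyP /(_ _ q0') [n0 H] := valP u.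
exists (ratr (N (u n0))); exists n0 => // n /= le_n.
rewrite /ball /= -rmorphB /= -[`|_|]ratr_norm (lt_trans _ qe) // ltr_rat.
by rewrite (le_lt_trans (rat_abs_dist _ _ _)) // H.
Qed.

Lemma Qp_abs_cvg (u : cauchySeq hp) :
  (fun n : nat => ratr (N (u n)) : R) @ \oo --> Qp_abs R (\pi_(Qp hp) u)%qT.
Proof.
rewrite /Qp_abs; set v := repr _.
have uv : (v - u) \in is_null hp.
  by rewrite Quotient.idealrBE /v reprK.
have cv := @cvg_rat_abs v.
rewrite -[lim _]addr0.
have -> : (fun n : nat => ratr (N (u n)) : R) =
   (fun n => ratr (N (v n)) + (ratr (N (u n)) - ratr (N (v n)))).
  by apply/funext => n; rewrite addrC subrK.
apply: cvgD => //; apply/cvgrPdist_lt => e e0.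
have [q] := rat_in_itvoo e0; rewrite in_itv /= => /andP[q0 qe].
have q0' : 0 < q by rewrite -(ltr0q R).
move/is_nullP: uv => /(_ _ q0') [n0 H].
exists n0 => // n /= le_n.
rewrite sub0r normrN -rmorphB /= -[`|_|]ratr_norm (lt_trans _ qe) // ltr_rat.
rewrite (le_lt_trans (rat_abs_dist _ _ _)) // rat_absB //.
exact: H le_n.
Qed.

Arguments Qp_abs_cvg u : clear implicits.

Lemma Qp_abs_eq (u : cauchySeq hp) (l : R) :
  (fun n : nat => ratr (N (u n)) : R) @ \oo --> l ->
  Qp_abs R (\pi_(Qp hp) u)%qT = l.
Proof. by move=> h; rewrite -(cvg_lim (@Rhausdorff R) h) (cvg_lim (@Rhausdorff R) (Qp_abs_cvg u)). Qed.

Lemma Qp_abs_ge0 (x : Qp hp) : 0 <= Qp_abs R x.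
Proof.
rewrite -[x]reprK; apply: (@cvgr_to_ge _ _ _ _ _ _ _ (Qp_abs_cvg (repr x))).
by apply: nearW => n; rewrite ler0q rat_abs_ge0.
Qed.

Lemma Qp_absM (x y : Qp hp) : Qp_abs R (x * y) = Qp_abs R x * Qp_abs R y.
Proof.
rewrite -[x]reprK -[y]reprK -pi_QpM; apply: Qp_abs_eq.
apply: cvg_trans (cvgM (Qp_abs_cvg (repr x)) (Qp_abs_cvg (repr y))).
apply: near_eq_cvg; apply: nearW => n.
transitivity (ratr (N (repr x n)) * ratr (N (repr y n)) : R) => //.
by rewrite -rmorphM -rat_absM.
Qed.

Lemma Qp_abs_rat (q : rat) (u : cauchySeq hp) : (forall n, u n = q) ->
  Qp_abs R (\pi_(Qp hp) u)%qT = ratr (N q).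
Proof.
move=> uq; apply: Qp_abs_eq.
by under eq_fun do rewrite uq; exact: cvg_cst.
Qed.

Lemma Qp_abs_int (n : int) : Qp_abs R (n%:~R : Qp hp) = ratr (N n%:~R).
Proof.
rewrite -(rmorph_int (\pi_(Qp hp))%qT); apply: Qp_abs_rat => k.
have nat_case (m : nat) : (m%:R : cauchySeq hp) k = m%:R.
  by elim: m => // m IH; rewrite -!natr1 -IH.
case: n => m; first exact: nat_case.
by rewrite NegzE !mulrNz -!pmulrn -nat_case.
Qed.

Let cvg_maxr (f g : nat -> R) (a b : R) : f @ \oo --> a -> g @ \oo --> b ->
  (fun n => Num.max (f n) (g n)) @ \oo --> Num.max a b.
Proof.
move=> fa gb; rewrite maxr_absE; under eq_fun do rewrite maxr_absE.
apply: cvgMr_tmp; apply: cvgD; first exact: cvgD.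
by apply: cvg_norm; apply: cvgB.
Qed.

Lemma Qp_absD (x y : Qp hp) :
  Qp_abs R (x + y) <= Num.max (Qp_abs R x) (Qp_abs R y).
Proof.
rewrite -[x]reprK -[y]reprK -pi_QpD.
have Hxy := Qp_abs_cvg (repr x + repr y).
apply: (ler_cvg_to Hxy (cvg_maxr (Qp_abs_cvg (repr x)) (Qp_abs_cvg (repr y)))).
apply: nearW => n; have := rat_absD hp (repr x n) (repr y n).
by rewrite !le_max !ler_rat.
Qed.

Lemma Qp_abs_sum_sq (x y : Qp hp) : p = 3 %[mod 4] ->
  Qp_abs R (x ^+ 2 + y ^+ 2) = Num.max (Qp_abs R x) (Qp_abs R y) ^+ 2.
Proof.
move=> hp3; rewrite -[x]reprK -[y]reprK !expr2 -!pi_QpM -pi_QpD.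
apply: Qp_abs_eq.
have H := cvg_maxr (Qp_abs_cvg (repr x)) (Qp_abs_cvg (repr y)).
apply: cvg_trans (cvgM H H); apply: near_eq_cvg; apply: nearW => n.
rewrite /= -[LHS]expr2 -[RHS]/(ratr (N (repr x n * repr x n + repr y n * repr y n))).
rewrite -!expr2 rat_abs_sum_sq // rmorphXn /=; congr (_ ^+ 2).
by rewrite !maxEle ler_rat; case: ifP.
Qed.

Lemma Qp_abs_eq0 (x : Qp hp) : (Qp_abs R x == 0) = (x == 0).
Proof.
apply/eqP/eqP => [|->]; last first.
  by have := Qp_abs_int 0; rewrite mulr0z rat_abs0 rmorph0.
rewrite -[x]reprK => x0; apply/eqP; rewrite Qp_eq0; apply/is_nullP => e e0.
have := Qp_abs_cvg (repr x); rewrite x0 => /cvgrPdist_lt /(_ (ratr e)).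
rewrite ltr0q => /(_ e0) [n0 _ H]; exists n0 => n /H /=.
by rewrite sub0r normrN -[`|_|]ratr_norm ltr_rat ger0_norm ?rat_abs_ge0.
Qed.

End QpAbs.

(* [GaussQp a b] is a + ib, with i^2 = -1.  The congruence on p is a parameter
   because -1 has to be a non-square in Q_p for this ring to be a field. *)
Record Qpi (p : nat) (hp : prime p) (hp3 : p = 3 %[mod 4]) :=
  GaussQp { Qpi_re : Qp hp; Qpi_im : Qp hp }.

Section QpiField.
Variables (p : nat) (hp : prime p) (hp3 : p = 3 %[mod 4]).
Local Notation K := (Qpi hp hp3).
Implicit Types x y z : K.

Let to_pair z := (Qpi_re z, Qpi_im z).
Let of_pair (ab : Qp hp * Qp hp) : K := GaussQp hp3 ab.1 ab.2.
Let to_pairK : cancel to_pair of_pair. Proof. by case. Qed.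

HB.instance Definition _ := Choice.copy K (can_type to_pairK).

Definition Qpi_add x y : K :=
  GaussQp hp3 (Qpi_re x + Qpi_re y) (Qpi_im x + Qpi_im y).
Definition Qpi_opp x : K := GaussQp hp3 (- Qpi_re x) (- Qpi_im x).
Definition Qpi_mul x y : K :=
  GaussQp hp3 (Qpi_re x * Qpi_re y - Qpi_im x * Qpi_im y)
              (Qpi_re x * Qpi_im y + Qpi_im x * Qpi_re y).

Lemma Qpi_ext (a b c d : Qp hp) : a = c -> b = d ->
  GaussQp hp3 a b = GaussQp hp3 c d.
Proof. by move=> -> ->. Qed.

Let addA : associative Qpi_add.
Proof. by move=> x y z; apply: Qpi_ext; rewrite /= addrA. Qed.
Let addC : commutative Qpi_add.
Proof. by move=> x y; apply: Qpi_ext; rewrite addrC. Qed.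
Let add0 : left_id (GaussQp hp3 0 0) Qpi_add.
Proof. by case=> a b; apply: Qpi_ext; rewrite /= add0r. Qed.
Let addN : left_inverse (GaussQp hp3 0 0) Qpi_opp Qpi_add.
Proof. by case=> a b; apply: Qpi_ext; rewrite /= addNr. Qed.

HB.instance Definition _ := GRing.isZmodule.Build K addA addC add0 addN.

Let mulA : associative Qpi_mul.
Proof. by move=> x y z; apply: Qpi_ext => /=; ring. Qed.
Let mulC : commutative Qpi_mul.
Proof. by move=> x y; apply: Qpi_ext => /=; ring. Qed.
Let mul1 : left_id (GaussQp hp3 1 0) Qpi_mul.
Proof. by case=> a b; apply: Qpi_ext => /=; ring. Qed.
Let mulD : left_distributive Qpi_mul Qpi_add.
Proof. by move=> x y z; apply: Qpi_ext => /=; ring. Qed.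
Let one_neq0 : GaussQp hp3 1 0 != 0.
Proof. by apply/eqP => -[] /eqP; rewrite oner_eq0. Qed.

HB.instance Definition _ :=
  GRing.Zmodule_isComNzRing.Build K mulA mulC mul1 mulD one_neq0.

Definition Qpi_i : K := GaussQp hp3 0 1.
Definition Qp_to_Qpi (a : Qp hp) : K := GaussQp hp3 a 0.
Definition Qpi_conj z : K := GaussQp hp3 (Qpi_re z) (- Qpi_im z).
Definition Qpi_norm z : Qp hp := Qpi_re z ^+ 2 + Qpi_im z ^+ 2.
Definition Qpi_inv z : K :=
  GaussQp hp3 (Qpi_re z / Qpi_norm z) (- Qpi_im z / Qpi_norm z).

Lemma Qp_sum_sq_eq0 (x y : Qp hp) : x ^+ 2 + y ^+ 2 = 0 -> x = 0 /\ y = 0.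
Proof.
rewrite -[x]reprK -[y]reprK !expr2 -!pi_QpM -pi_QpD.
move: (repr x) (repr y) => u v /eqP; rewrite Qp_eq0 => /is_nullP H.
suff uv0 : forall e : rat, 0 < e -> exists n0 : nat, forall n : nat,
    (n0 <= n)%N -> Num.max (rat_abs p (u n)) (rat_abs p (v n)) < e.
  split; apply/eqP; rewrite Qp_eq0; apply/is_nullP => e /uv0 [n0 Hn];
    exists n0 => n /Hn; by rewrite gt_max => /andP[].
move=> e e0; have [n0 Hn] := H _ (exprn_gt0 2 e0); exists n0 => n /Hn.
have -> : (u * u + v * v : cauchySeq hp) n = u n ^+ 2 + v n ^+ 2.
  by rewrite !expr2.
rewrite rat_abs_sum_sq // ltr_pXn2r // nnegrE ?le_max ?rat_abs_ge0 //.
exact: ltW.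
Qed.

Lemma Qpi_norm_eq0 z : Qpi_norm z = 0 -> z = 0.
Proof. by case: z => a b /Qp_sum_sq_eq0 /= [-> ->]. Qed.

Lemma Qpi_mulVf z : z != 0 -> Qpi_inv z * z = 1.
Proof.
move=> z0; have : Qpi_norm z != 0 by apply: contra_neq z0; apply: Qpi_norm_eq0.
case: z {z0} => a b; rewrite /Qpi_norm /= => N0; set n := _ + _ in N0.
apply: Qpi_ext; rewrite /= /Qpi_norm /= -/n.
  by rewrite !mulNr opprK ![_ / n * _]mulrAC -mulrDl -!expr2 divff.
by rewrite mulNr mulNr ![_ / n * _]mulrAC [b * a]mulrC subrr.
Qed.

Lemma Qpi_inv0 : Qpi_inv 0 = 0.
Proof. by apply: Qpi_ext; rewrite /= ?oppr0 mul0r. Qed.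

HB.instance Definition _ := GRing.ComNzRing_isField.Build K Qpi_mulVf Qpi_inv0.

Lemma sqr_Qpi_i : Qpi_i ^+ 2 = -1.
Proof. by rewrite expr2; apply: Qpi_ext => /=; ring. Qed.

Lemma Qp_to_Qpi_monoid_morphism : monoid_morphism Qp_to_Qpi.
Proof. by split=> // a b; apply: Qpi_ext => /=; ring. Qed.
Lemma Qp_to_Qpi_zmod_morphism : zmod_morphism Qp_to_Qpi.
Proof. by move=> a b; apply: Qpi_ext => /=; ring. Qed.

HB.instance Definition _ := GRing.isZmodMorphism.Build (Qp hp) K
  Qp_to_Qpi Qp_to_Qpi_zmod_morphism.
HB.instance Definition _ := GRing.isMonoidMorphism.Build (Qp hp) K
  Qp_to_Qpi Qp_to_Qpi_monoid_morphism.

Lemma QpiE z : z = Qp_to_Qpi (Qpi_re z) + Qpi_i * Qp_to_Qpi (Qpi_im z).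
Proof. by case: z => a b; apply: Qpi_ext => /=; ring. Qed.

Lemma Qpi_conjE (a b : Qp hp) :
  Qpi_conj (Qp_to_Qpi a + Qpi_i * Qp_to_Qpi b)
  = Qp_to_Qpi a - Qpi_i * Qp_to_Qpi b.
Proof. by apply: Qpi_ext => /=; ring. Qed.

Lemma Qpi_normE z : Qp_to_Qpi (Qpi_norm z) = z * Qpi_conj z.
Proof. by case: z => a b; apply: Qpi_ext; rewrite /= /Qpi_norm /=; ring. Qed.

Lemma Qpi_normM x y : Qpi_norm (x * y) = Qpi_norm x * Qpi_norm y.
Proof. by rewrite /Qpi_norm /=; ring. Qed.

End QpiField.

(* |z| = sqrt |z * conj z|; [Qpi_abs_absolute_value], [Qpi_abs_extends] and
   [Qpi_abs_unique] show that it is the absolute value extending that of Q_p. *)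
Definition Qpi_abs (R : realType) (p : nat) (hp : prime p)
    (hp3 : p = 3 %[mod 4]) (z : Qpi hp hp3) : R :=
  Num.sqrt (Qp_abs R (Qpi_norm z)).

Definition absolute_value (R : realType) (K : fieldType) (f : K -> R) : Prop :=
  [/\ forall x, 0 <= f x,
      forall x, f x = 0 <-> x = 0,
      forall x y, f (x * y) = f x * f y
    & forall x y, f (x + y) <= f x + f y].

Section QpiAbs.
Variables (R : realType) (p : nat) (hp : prime p) (hp3 : p = 3 %[mod 4]).
Local Notation K := (Qpi hp hp3).

Lemma Qpi_absE (z : K) :
  Qpi_abs R z = Num.max (Qp_abs R (Qpi_re z)) (Qp_abs R (Qpi_im z)).
Proof.
by rewrite /Qpi_abs Qp_abs_sum_sq // sqrtr_sqr ger0_norm // le_max Qp_abs_ge0.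
Qed.

Lemma Qpi_abs_ge0 (z : K) : 0 <= Qpi_abs R z.
Proof. exact: sqrtr_ge0. Qed.

Lemma Qpi_abs_eq0 (z : K) : Qpi_abs R z = 0 <-> z = 0.
Proof.
split=> [/eqP|->]; last first.
  by rewrite Qpi_absE; apply/eqP; rewrite maxxx Qp_abs_eq0.
rewrite sqrtr_eq0 => z0; apply/Qpi_norm_eq0/eqP.
by rewrite -(Qp_abs_eq0 R) eq_le z0 Qp_abs_ge0.
Qed.

Lemma Qpi_absM (x y : K) : Qpi_abs R (x * y) = Qpi_abs R x * Qpi_abs R y.
Proof. by rewrite /Qpi_abs Qpi_normM Qp_absM sqrtrM // Qp_abs_ge0. Qed.

Lemma Qpi_absD (x y : K) :
  Qpi_abs R (x + y) <= Num.max (Qpi_abs R x) (Qpi_abs R y).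
Proof.
rewrite !Qpi_absE.
move: (Qp_absD R (Qpi_re x) (Qpi_re y)) (Qp_absD R (Qpi_im x) (Qpi_im y)).
rewrite -[Qpi_re x + _]/(Qpi_re (x + y)) -[Qpi_im x + _]/(Qpi_im (x + y)).
move: (Qp_abs R (Qpi_re x)) (Qp_abs R (Qpi_re y)) (Qp_abs R (Qpi_re (x + y))).
move: (Qp_abs R (Qpi_im x)) (Qp_abs R (Qpi_im y)) (Qp_abs R (Qpi_im (x + y))).
move=> b d bd a c ac; rewrite ge_max !le_max => /orP[->|->] /orP[->|->];
  by rewrite ?orbT.
Qed.

Lemma Qpi_abs_absolute_value : absolute_value (@Qpi_abs R p hp hp3).
Proof.
split; [exact: Qpi_abs_ge0|exact: Qpi_abs_eq0|exact: Qpi_absM|move=> x y].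
apply: le_trans (Qpi_absD x y) _.
by rewrite ge_max lerDl lerDr !Qpi_abs_ge0.
Qed.

Lemma Qpi_abs_extends (a : Qp hp) :
  Qpi_abs R (Qp_to_Qpi hp3 a) = Qp_abs R a.
Proof.
rewrite /Qpi_abs /Qpi_norm /= expr0n addr0 expr2 Qp_absM -expr2 sqrtr_sqr.
by rewrite ger0_norm // Qp_abs_ge0.
Qed.

Lemma Qpi_abs_unique (f : K -> R) : absolute_value f ->
  (forall a : Qp hp, f (Qp_to_Qpi hp3 a) = Qp_abs R a) ->
  forall z, f z = Qpi_abs R z.
Proof.
case=> f0 fe0 fM fD fext.
have f1 : f 1 = 1.
  have : f 1 != 0 by apply/eqP => /fe0 /eqP; rewrite oner_eq0.
  by move=> /mulfI; apply; rewrite -fM !mulr1.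
have fN1 : f (-1) = 1.
  have : f (-1) ^+ 2 = 1 by rewrite expr2 -fM mulrNN mulr1 f1.
  by move/eqP; rewrite sqrf_eq1 => /orP[/eqP //|/eqP E]; have := f0 (-1); rewrite E; lra.
have fi : f (Qpi_i hp hp3) = 1.
  have : f (Qpi_i hp hp3) ^+ 2 = 1 by rewrite expr2 -fM -expr2 sqr_Qpi_i fN1.
  by move/eqP; rewrite sqrf_eq1 => /orP[/eqP //|/eqP E]; have := f0 (Qpi_i hp hp3); rewrite E; lra.
have fX (z : K) n : f (z ^+ n) = f z ^+ n.
  by elim: n => [|n IH]; rewrite ?expr0 // !exprS fM IH.
have aX (z : K) n : Qpi_abs R (z ^+ n) = Qpi_abs R z ^+ n.
  elim: n => [|n IH]; last by rewrite !exprS Qpi_absM IH.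
  by rewrite !expr0 -(rmorph1 (Qp_to_Qpi hp3)) Qpi_abs_extends -fext rmorph1.
have f_le2 (z : K) : Qpi_abs R z <= 1 -> f z <= 2.
  rewrite Qpi_absE ge_max => /andP[? ?].
  rewrite (QpiE z) (le_trans (fD _ _)) // fM fi mul1r !fext.
  by rewrite -[2]/(1 + 1) lerD.
have f_le1 (z : K) : Qpi_abs R z <= 1 -> f z <= 1.
  move=> z1; rewrite leNgt; apply/negP => fz1.
  have bern n : 1 + n%:R * (f z - 1) <= f z ^+ n.
    elim: n => [|n IH]; first by rewrite mul0r addr0 expr0.
    rewrite exprS -natr1; apply: le_trans (ler_wpM2l (f0 z) IH).
    have := mulr_ge0 (ler0n R n) (sqr_ge0 (f z - 1)).
    by rewrite -subr_ge0 => H; rewrite -subr_ge0; congr (0 <= _): H; ring.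
  pose n := (Num.truncn (1 / (f z - 1))).+1.
  have Hn : 1 / (f z - 1) < n%:R by rewrite truncnS_gt.
  have := f_le2 (z ^+ n); rewrite aX fX => /(_ _).
  have -> : Qpi_abs R z ^+ n <= 1 by rewrite exprn_ile1 // sqrtr_ge0.
  move=> /(_ isT); have := bern n; rewrite ltr_pdivrMr in Hn; last by lra.
  lra.
move=> z; have [->|z0] := eqVneq z 0.
  by rewrite (fe0 0).2 // (Qpi_abs_eq0 0).2.
have a_neq0 (y : K) : y != 0 -> Qpi_abs R y != 0.
  by apply: contra_neq => /Qpi_abs_eq0.
have f_eq1 (y : K) : Qpi_abs R y = 1 -> f y = 1.
  move=> y1; have y0 : y != 0.
    by apply: contra_eq_neq y1 => ->; rewrite (Qpi_abs_eq0 0).2 // eq_sym oner_neq0.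
  apply/eqP; rewrite eq_le f_le1 ?y1 //=.
  have yV1 : f y^-1 <= 1.
    apply: f_le1; have := Qpi_absM y y^-1; rewrite divff // y1 mul1r => <-.
    by rewrite -(expr0 0) aX expr0.
  have E : f y * f y^-1 = 1 by rewrite -fM divff.
  by have := f0 y; nra.
have cz0 : Qpi_conj z != 0.
  apply: contra_neq z0; case: (z) => a b /= -[-> /eqP].
  by rewrite oppr_eq0 => /eqP ->.
have acz : Qpi_abs R (Qpi_conj z) = Qpi_abs R z.
  by rewrite /Qpi_abs /Qpi_norm /= sqrrN.
have fcz : f (Qpi_conj z) = f z.
  have : f (Qpi_conj z / z) = 1.
    apply: f_eq1; apply: (mulIf (a_neq0 z z0)).
    by rewrite -Qpi_absM divfK // mul1r.
  by move=> E; rewrite -[RHS]mul1r -E -fM divfK.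
apply/eqP; rewrite -(@eqrXn2 _ 2) ?f0 ?sqrtr_ge0 //.
rewrite [X in X == _]expr2 -[X in _ * X]fcz -fM -Qpi_normE fext.
by rewrite sqr_sqrtr // Qp_abs_ge0.
Qed.

End QpiAbs.

Definition is_loop (L : Type) (e : L) (op : L -> L -> L) : Prop :=
  [/\ forall a, op a e = a /\ op e a = a,
      forall a b, exists! x, op a x = b
    & forall a b, exists! y, op y a = b].

Definition left_translation (L : Type) (op : L -> L -> L) (a : L) : L -> L :=
  fun x => op a x.

(* In a loop, [inv_translation e op a b] is the unique x with a (+) x = b; the
   default value [e] is irrelevant. *)
Definition inv_translation (L : choiceType) (e : L) (op : L -> L -> L) (a : L) :
    L -> L :=
  fun b => xget e [set x | left_translation op a x = b].

Definition left_inner_deviation (L : choiceType) (e : L) (op : L -> L -> L)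
    (a b : L) : L -> L :=
  inv_translation e op (op a b) \o left_translation op a \o left_translation op b.

Definition loop_automorphism (L : Type) (op : L -> L -> L) (f : L -> L) : Prop :=
  bijective f /\ {morph f : x y / op x y}.

Definition is_Al_loop (L : choiceType) (e : L) (op : L -> L -> L) : Prop :=
  is_loop e op /\
  forall a b, loop_automorphism op (left_inner_deviation e op a b).

Definition left_inverse_property (L : Type) (op : L -> L -> L) : Prop :=
  forall a, exists a', forall x, op a' (op a x) = x.

Definition open_disc (R : realType) (p : nat) (hp : prime p)
    (hp3 : p = 3 %[mod 4]) : choiceType :=
  {z : Qpi hp hp3 | Qpi_abs R z < 1}.

(* Main.v *)
(** Writing x (+) y = (x + y) / (1 - conj x * y), the left translation by a is
    the Moebius map of the matrix [[1, a], [- conj a, 1]], and the translation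
    by - a inverts it.  The equation y (+) a = b is real-linear in y: it reads
    y + a b conj y = b - a, and eliminating conj y leaves the factor
    1 - a b conj (a b), nonzero since |a b| < 1; the difference t of two
    solutions satisfies |t| = |a b| |t|, so t = 0.  Multiplying the matrices of
    two left translations shows that the left inner deviation of a and b is
    x |-> u x with u = (1 - a conj b) / (1 - conj a b).  As u conj u = 1, this
    rotation preserves (+). *)

Require Import Defs.
From HB Require Import structures.
From mathcomp Require Import all_boot all_order all_algebra.
From mathcomp Require Import ring.
From mathcomp Require Import all_classical all_reals all_analysis.
Set Implicit Arguments.
Unset Strict Implicit.
Unset Printing Implicit Defensive.
Import Order.TTheory GRing.Theory Num.Theory.
Local Open Scope ring_scope.

(** * Left inner deviations under left cancellation *)

Section LeftInnerDeviation.
Local Open Scope classical_set_scope.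
Variables (L : choiceType) (e : L) (op : L -> L -> L).
Hypothesis op_inj : forall a, injective (op a).

(** The solution picked by [xget] is the only one; [y] witnesses existence, so the default [e] is
    never returned. *)
Lemma left_inner_deviation_eq (a b x y : L) :
  op (op a b) y = op a (op b x) -> left_inner_deviation e op a b x = y.
Proof.
move=> E; apply: (op_inj (a := op a b)); rewrite E.
exact: (@xgetPex _ e [set z | op (op a b) z = op a (op b x)]) (ex_intro _ y E).
Qed.

End LeftInnerDeviation.

(** * Ultrametric absolute values with an isometric involution *)

Section UltrametricDisc.
Variables (R : realFieldType) (K : fieldType).
Variables (conj : {rmorphism K -> K}) (abs : K -> R).
Hypothesis conjK : involutive conj.
Hypothesis abs_ge0 : forall x, 0 <= abs x.
Hypothesis abs_eq0 : forall x, abs x = 0 <-> x = 0.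
Hypothesis absM : {morph abs : x y / x * y}.
Hypothesis absD : forall x y, abs (x + y) <= Num.max (abs x) (abs y).
Hypothesis abs_conj : forall x, abs (conj x) = abs x.
Local Notation D := {x : K | abs x < 1}.

Lemma abs0 : abs 0 = 0. Proof. exact/abs_eq0. Qed.

Lemma abs1 : abs 1 = 1.
Proof.
have a1 : abs 1 != 0 by apply/eqP => /abs_eq0 /eqP; rewrite oner_eq0.
by apply: (mulfI a1); rewrite -absM !mulr1.
Qed.

Lemma absV (z : K) : abs z^-1 = (abs z)^-1.
Proof.
have [->|z0] := eqVneq z 0; first by rewrite invr0 abs0 invr0.
have a0 : abs z != 0 by apply: contra_neq z0 => /abs_eq0.
by apply: (mulfI a0); rewrite -absM !divff // abs1.
Qed.

Lemma absN (x : K) : abs (- x) = abs x.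
Proof.
have /eqP : abs (-1) ^+ 2 = 1 by rewrite expr2 -absM mulrNN mulr1 abs1.
rewrite sqrf_eq1 -[- x]mulN1r absM => /orP[] /eqP E; first by rewrite E mul1r.
by have := abs_ge0 (-1); rewrite E oppr_ge0 ler10.
Qed.

Lemma absD_lt1 (x y : K) : abs x < 1 -> abs y < 1 -> abs (x + y) < 1.
Proof. by move=> x1 y1; rewrite (le_lt_trans (absD _ _)) // gt_max x1. Qed.

Lemma absM_lt1 (x y : K) : abs x < 1 -> abs y < 1 -> abs (x * y) < 1.
Proof. by move=> x1 y1; rewrite absM mulr_ilt1 ?abs_ge0. Qed.

(** If |1 - z| < 1, then 1 = (1 - z) + z would have absolute value below 1. Hence the denominators
    of (+) on the disc have absolute value 1. *)
Lemma abs_1B (z : K) : abs z < 1 -> abs (1 - z) = 1.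
Proof.
move=> z1; apply/eqP; rewrite eq_le; apply/andP; split.
  by rewrite (le_trans (absD _ _)) // ge_max abs1 lexx absN ltW.
rewrite leNgt; apply/negP => lt1; have := absD_lt1 lt1 z1.
by rewrite subrK abs1 ltxx.
Qed.

Lemma sub1_neq0 (z : K) : abs z < 1 -> 1 - z != 0.
Proof.
move=> z1; apply/eqP => E; have := abs_1B z1.
by rewrite E abs0 => /eqP; rewrite eq_sym oner_eq0.
Qed.

(** * Moebius addition and its two divisions *)

Definition disc_add_val (x y : K) : K := (x + y) / (1 - conj x * y).

Lemma disc_denom_neq0 (x y : K) : abs x < 1 -> abs y < 1 ->
  1 - conj x * y != 0.
Proof. by move=> x1 y1; rewrite sub1_neq0 // absM_lt1 ?abs_conj. Qed.

Lemma disc_add_val_lt1 (x y : K) : abs x < 1 -> abs y < 1 ->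
  abs (disc_add_val x y) < 1.
Proof.
move=> x1 y1; rewrite absM absV abs_1B ?invr1 ?mulr1.
  exact: absD_lt1.
by rewrite absM_lt1 ?abs_conj.
Qed.

Lemma disc_add_valK (x y : K) : abs x < 1 -> abs y < 1 ->
  disc_add_val (- x) (disc_add_val x y) = y.
Proof.
move=> x1 y1; rewrite /disc_add_val rmorphN /=.
have d0 := disc_denom_neq0 x1 y1.
have nx : abs (- x) < 1 by rewrite absN.
have := disc_denom_neq0 nx x1; rewrite rmorphN /= mulNr opprK => e0.
field; rewrite d0 /=.
(* The outer denominator, cleared of the inner one, is the denominator of (- x) (+) x. *)
by have -> : 1 - conj x * y - - conj x * (x + y) = 1 + conj x * x by ring.
Qed.

(** This [y] comes from substituting conj y = conj c - conj (a b) y into y + a b conj y = c. Its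
    denominator has absolute value 1, so |y| is that of the numerator. *)
Lemma disc_add_val_solve_left (a b : K) : abs a < 1 -> abs b < 1 ->
  let c := b - a in let y := (c - a * b * conj c) / (1 - a * b * conj (a * b)) in
  abs y < 1 /\ disc_add_val y a = b.
Proof.
move=> a1 b1 c y; have ab1 := absM_lt1 a1 b1.
have n1 : abs (a * b * conj (a * b)) < 1 by rewrite absM_lt1 ?abs_conj.
have c1 : abs c < 1 by rewrite absD_lt1 ?absN.
have y1 : abs y < 1.
  rewrite absM absV abs_1B // invr1 mulr1 absD_lt1 // absN.
  by rewrite absM_lt1 ?abs_conj.
split=> //; apply: (canLR (mulfK (disc_denom_neq0 y1 a1))).
have := sub1_neq0 n1.
rewrite /y /c fmorph_div !(rmorphB, rmorphM, rmorph1) /= !conjK.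
(* The denominator is its own conjugate up to the order of the factors, and conj y shows it in the
   swapped order. *)
move=> n0; have n0' : 1 - conj a * conj b * (a * b) != 0 by rewrite mulrC.
by field; rewrite n0'.
Qed.

Lemma disc_add_val_left_inj (a x y : K) : abs a < 1 -> abs x < 1 -> abs y < 1 ->
  disc_add_val x a = disc_add_val y a -> x = y.
Proof.
move=> a1 x1 y1 E; pose b := disc_add_val x a.
have b1 : abs b < 1 by exact: disc_add_val_lt1.
have solve z : abs z < 1 -> disc_add_val z a = b -> z + a * b * conj z = b - a.
  move=> z1 /(canRL (divfK (disc_denom_neq0 z1 a1))) Ez.
  by apply: (addIr a); rewrite addrAC Ez; ring.
have Ex := solve x x1 erefl; have Ey := solve y y1 (esym E).
pose t := x - y; have Et : t = - (a * b) * conj t.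
  rewrite /t rmorphB /=; apply/subr0_eq.
  transitivity ((x + a * b * conj x) - (y + a * b * conj y)); first by ring.
  by rewrite Ex Ey subrr.
apply/eqP; rewrite -subr_eq0 -/t; apply/negPn/negP => t0.
have ab1 : abs (a * b) < 1 by apply: absM_lt1.
have : abs t < abs t; last by rewrite ltxx.
rewrite {1}Et absM absN abs_conj gtr_pMl //.
rewrite lt_def abs_ge0 andbT; apply/eqP => /abs_eq0 /eqP.
by rewrite (negbTE t0).
Qed.

(** * Gyrations: multiplication by a quotient of conjugate elements *)

Definition gyr (a b : K) : K := (1 - a * conj b) / (1 - conj a * b).

Lemma conj_gyr (a b : K) : conj (gyr a b) = (gyr a b)^-1.
Proof.
by rewrite /gyr fmorph_div !(rmorphB, rmorphM, rmorph1) /= !conjK invf_div.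
Qed.

Lemma disc_denom_conj_neq0 (x y : K) : abs x < 1 -> abs y < 1 ->
  1 - x * conj y != 0.
Proof. by move=> x1 y1; rewrite sub1_neq0 // absM_lt1 ?abs_conj. Qed.

Lemma gyr_neq0 (a b : K) : abs a < 1 -> abs b < 1 -> gyr a b != 0.
Proof.
by move=> a1 b1; rewrite mulf_neq0 ?invr_eq0 ?disc_denom_neq0 ?disc_denom_conj_neq0.
Qed.

Lemma abs_gyr (a b : K) : abs a < 1 -> abs b < 1 -> abs (gyr a b) = 1.
Proof.
move=> a1 b1; rewrite absM absV !abs_1B ?divr1 //.
  by rewrite absM_lt1 ?abs_conj.
by rewrite absM_lt1 ?abs_conj.
Qed.

(** Both sides equal ((1 - a conj b) x + a + b) / (1 - conj a b - (conj a + conj b) x). *)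
Lemma disc_add_val_gyr (a b x : K) : abs a < 1 -> abs b < 1 -> abs x < 1 ->
  disc_add_val (disc_add_val a b) (gyr a b * x) = disc_add_val a (disc_add_val b x).
Proof.
move=> a1 b1 x1.
have := disc_denom_neq0 a1 (disc_add_val_lt1 b1 x1).
have d1 := disc_denom_neq0 a1 b1; have d2 := disc_denom_neq0 b1 x1.
have d3 := disc_denom_conj_neq0 a1 b1.
rewrite /disc_add_val /gyr fmorph_div !(rmorphB, rmorphD, rmorphM, rmorph1) /= !conjK.
move: (conj a) (conj b) d1 d2 d3 => a' b' d1 d2 d3 e2.
(* This common denominator of both sides is a product of two nonzero denominators from the
   right-hand side. *)
have e3 : 1 - b' * x - a' * (b + x) != 0.
  move: e2; apply: contra_neq => e2.
  by apply: (mulIf d2); rewrite mul0r -e2 mulrBl mul1r mulrA divfK.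
by field; rewrite d1 d2 d3 e3.
Qed.

(** The numerator is linear, and conj u * u = 1 leaves the denominator unchanged. *)
Lemma disc_add_val_rot (u x y : K) : u != 0 -> conj u = u^-1 ->
  disc_add_val (u * x) (u * y) = u * disc_add_val x y.
Proof.
move=> u0 uV; rewrite /disc_add_val rmorphM /= uV -mulrDr -mulrA.
by rewrite mulrACA mulVf // mul1r.
Qed.

(** * The loop on the disc and its inner deviations *)

Lemma disc_valP (x : D) : abs (val x) < 1. Proof. exact: (valP x). Qed.

Definition to_disc (x : K) (x1 : abs x < 1) : D := exist _ x x1.

Definition disc_zero : D := to_disc (eq_ind_r (fun r => r < 1) ltr01 abs0).

Definition disc_add (x y : D) : D :=
  to_disc (disc_add_val_lt1 (valP x) (valP y)).

Definition disc_opp (x : D) : D :=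
  to_disc (eq_ind_r (fun r => r < 1) (valP x) (absN (val x))).

Lemma disc_addK (a x : D) : disc_add (disc_opp a) (disc_add a x) = x.
Proof. by apply/val_inj; rewrite /= disc_add_valK ?disc_valP. Qed.

Lemma disc_add_inj (a : D) : injective (disc_add a).
Proof. exact: can_inj (disc_addK a). Qed.

Lemma disc_oppK : involutive disc_opp.
Proof. by move=> x; apply/val_inj; rewrite /= opprK. Qed.

Lemma disc_loop : is_loop disc_zero disc_add.
Proof.
split=> [a|a b|a b].
- split; apply/val_inj; rewrite /= /disc_add_val.
    by rewrite mulr0 subr0 addr0 divr1.
  by rewrite rmorph0 mul0r subr0 add0r divr1.
- exists (disc_add (disc_opp a) b); split=> [|x <-]; last exact: disc_addK.
  (* Since a = - (- a), left cancellation at - a shows that the witness solves the equation. *)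
  by rewrite -{1}[a]disc_oppK disc_addK.
have [y1 yE] := disc_add_val_solve_left (disc_valP a) (disc_valP b).
exists (to_disc y1); split=> [|y' E]; apply/val_inj => //=.
apply: (disc_add_val_left_inj (disc_valP a)) => //; first exact: disc_valP.
by rewrite yE -E.
Qed.

Lemma rot_lt1 (u : K) (x : D) : abs u = 1 -> abs (u * val x) < 1.
Proof. by move=> u1; rewrite absM u1 mul1r disc_valP. Qed.

Definition disc_gyr (a b x : D) : D :=
  to_disc (rot_lt1 x (abs_gyr (valP a) (valP b))).

Lemma left_inner_deviation_gyr (a b : D) :
  left_inner_deviation disc_zero disc_add a b = disc_gyr a b.
Proof.
apply/funext => x; apply: (left_inner_deviation_eq _ disc_add_inj).
by apply/val_inj; rewrite /= disc_add_val_gyr ?disc_valP.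
Qed.

Lemma disc_gyr_automorphism (a b : D) : loop_automorphism disc_add (disc_gyr a b).
Proof.
have [a1 b1] := (disc_valP a, disc_valP b).
split; last first.
  move=> x y; apply/val_inj; rewrite /= disc_add_val_rot ?gyr_neq0 //.
  exact: conj_gyr.
(* The inverse map is multiplication by the inverse of the gyration factor, which also preserves the
   disc. *)
have g'1 : abs (gyr (val a) (val b))^-1 = 1 by rewrite absV abs_gyr ?invr1.
exists (fun x => to_disc (rot_lt1 x g'1)) => x; apply/val_inj => /=.
  by rewrite mulKf ?gyr_neq0.
by rewrite mulVKf ?gyr_neq0.
Qed.

End UltrametricDisc.

(** * Conjugation of Q_p(i) as an isometric involution *)

Section QpiConj.
Variables (p : nat) (hp : prime p) (hp3 : p = 3 %[mod 4]).
Local Notation K := (Qpi hp hp3).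
Local Notation conj := (@Qpi_conj p hp hp3).

Lemma Qpi_conj_zmod_morphism : zmod_morphism conj.
Proof. by move=> x y; apply: Qpi_ext => /=; ring. Qed.

Lemma Qpi_conj_monoid_morphism : monoid_morphism conj.
Proof. by split=> [|x y]; apply: Qpi_ext => /=; ring. Qed.

HB.instance Definition _ := GRing.isZmodMorphism.Build K K
  conj Qpi_conj_zmod_morphism.
HB.instance Definition _ := GRing.isMonoidMorphism.Build K K
  conj Qpi_conj_monoid_morphism.

Lemma Qpi_conjK : involutive conj.
Proof. by case=> a b; apply: Qpi_ext => /=; rewrite ?opprK. Qed.

Lemma Qpi_abs_conj (R : realType) (z : K) : Qpi_abs R (conj z) = Qpi_abs R z.
Proof. by rewrite /Qpi_abs /Qpi_norm /= sqrrN. Qed.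

End QpiConj.

Theorem mainTheorem1 (R : realType) (p : nat) (hp : prime p)
    (hp3 : p = 3 %[mod 4]) :
  exists (zero : open_disc R hp hp3)
         (oplus : open_disc R hp hp3 -> open_disc R hp hp3 -> open_disc R hp hp3),
    [/\ val zero = 0,
        forall xi1 xi2 : open_disc R hp hp3,
          1 - Qpi_conj (val xi1) * val xi2 <> 0 /\
          val (oplus xi1 xi2)
          = (val xi1 + val xi2) / (1 - Qpi_conj (val xi1) * val xi2),
        is_Al_loop zero oplus
      & left_inverse_property oplus].
Proof.
have [ge0 eq0] := (@Qpi_abs_ge0 R p hp hp3, @Qpi_abs_eq0 R p hp hp3).
have [absM absD] := (@Qpi_absM R p hp hp3, @Qpi_absD R p hp hp3).
have [conjK absC] := (@Qpi_conjK p hp hp3, @Qpi_abs_conj p hp hp3 R).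
(* [open_disc] unfolds to the disc of the abstract setting, so the value of [zero] and the formula
   for [oplus] hold by computation. *)
exists (disc_zero eq0), (disc_add ge0 eq0 absM absD absC); split=> //.
- move=> x y; split=> //; apply/eqP.
  exact: (disc_denom_neq0 ge0 eq0 absM absD absC (valP x) (valP y)).
- split=> [|a b]; first exact: (disc_loop conjK).
  rewrite (left_inner_deviation_gyr conjK) //.
  exact: (disc_gyr_automorphism conjK).
- by move=> a; exists (disc_opp ge0 eq0 absM a) => x; rewrite disc_addK.
Qed.
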